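(* Let $0<q<1$. The following hold. (a) If $n\in\mathbb N$ (positive integer) and $\widetilde h_n(x;q)$ is the discrete $q$-Hermite II polynomial of degree $n$, then $$\int\frac{\widetilde h_n(x;q)}{(-x^2;q^2)_\infty}\,d_qx=-\frac{q^{1-n}(1-q)}{(-x^2;q^2)_\infty}\,\widetilde h_{n-1}(x;q).$$ (b) If $\nu$ is a real number with $\nu>-1$, then for $x>0$ $$\int\frac{qx^2-q^{1-\nu}[\nu]_q^2}{x(-x^2(1-q)^2;q^2)_\infty}J^{(2)}_\nu(x|q^2)\,d_qx=\frac{-x}{(-x^2(1-q)^2;q^2)_\infty}D_{q^{-1}}J^{(2)}_\nu(x|q^2).$$
   Context: $[\nu]_q=\frac{1-q^\nu}{1-q}$ for real $\nu$; $(a;q)_k=\prod_{j=0}^{k-1}(1-aq^j)$, $(a;q)_\infty=\prod_{j\ge0}(1-aq^j)$, $(a,b;q)_k=(a;q)_k(b;q)_k$. For $x\neq0$, $D_qf(x)=\frac{f(x)-f(qx)}{(1-q)x}$ and $D_{q^{-1}}f(x)=\frac{f(x)-f(x/q)}{(1-q^{-1})x}$; the indefinite $q$-integral $\int f(x)\,d_qx=F(x)$ means $D_qF(x)=f(x)$. Definitions: for integers $n\ge0$, $\widetilde h_n(x;q)=x^n\sum_{k\ge0}\frac{(q^{-n};q^2)_k(q^{-n+1};q^2)_k}{(q^2;q^2)_k}\big(\frac{-q^2}{x^2}\big)^k$ (a terminating sum, polynomial in $x$); and $$J^{(2)}_\nu(x|q^2)=\frac{(q^{2\nu+2};q^2)_\infty}{(q^2;q^2)_\infty}\sum_{n\ge0}\frac{(-1)^nq^{2n(n+\nu)}}{(q^2,q^{2\nu+2};q^2)_n}\big(x(1-q)\big)^{2n+\nu},$$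 the second Jackson $q$-Bessel function $J_\nu^{(2)}(2x(1-q);q^2)$. *)

(* Defs.v *)
From HB Require Import structures.
From mathcomp Require Import all_boot all_order all_algebra.
From mathcomp Require Import all_classical all_reals all_analysis.

Set Implicit Arguments.
Unset Strict Implicit.
Unset Printing Implicit Defensive.

Import Order.TTheory GRing.Theory Num.Theory.
Import numFieldNormedType.Exports.

Local Open Scope classical_set_scope.
Local Open Scope ring_scope.

(* Powers: [x ^+ n] has a natural exponent, [x ^ m] an integer exponent and
   [x `^ a] a real exponent (the latter is only used here for x > 0). *)

Definition qnum (R : realType) (q nu : R) : R := (1 - q `^ nu) / (1 - q).

Definition qpoch (R : realType) (a q : R) (k : nat) : R :=
  \prod_(0 <= j < k) (1 - a * q ^+ j).

Definition qpoch_inf (R : realType) (a q : R) : R :=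
  limn (fun k : nat => qpoch a q k).

(* Only meaningful for x != 0. The operator D_{q^{-1}} is [Dq q^-1]. *)
Definition Dq (R : realType) (q : R) (f : R -> R) (x : R) : R :=
  (f x - f (q * x)) / ((1 - q) * x).

(* The indefinite q-integral: "int f(x) d_q x = F(x) for x in A". *)
Definition is_qintegral (R : realType) (q : R) (A : set R) (f F : R -> R) :
  Prop := forall x : R, A x -> Dq q F x = f x.

(* Discrete q-Hermite II polynomial of degree n. The series terminates, since
   one of the two factors in the numerator vanishes as soon as 2k > n. As this
   formula involves x^{-2}, it gives the value of the polynomial only for
   x != 0. *)
Definition qhermite2 (R : realType) (n : nat) (x q : R) : R :=
  x ^+ n * limn (series (fun k : nat =>
    qpoch (q ^ (- n%:Z)) (q ^+ 2) k * qpoch (q ^ (- n%:Z + 1)) (q ^+ 2) k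
    / qpoch (q ^+ 2) (q ^+ 2) k * (- q ^+ 2 / x ^+ 2) ^+ k)).

(* [qbesselJ2 nu x q] is J_nu^(2)(x|q^2), i.e. the second Jackson q-Bessel
   function J_nu^(2)(2x(1-q); q^2), for x > 0. *)
Definition qbesselJ2 (R : realType) (nu x q : R) : R :=
  qpoch_inf (q `^ (2 * nu + 2)) (q ^+ 2) / qpoch_inf (q ^+ 2) (q ^+ 2)
  * limn (series (fun n : nat =>
      (-1) ^+ n * q `^ (2 * n%:R * (n%:R + nu))
      / (qpoch (q ^+ 2) (q ^+ 2) n * qpoch (q `^ (2 * nu + 2)) (q ^+ 2) n)
      * (x * (1 - q)) `^ (2 * n%:R + nu))).

(* Main.v *)
Require Import Defs.
From mathcomp Require Import all_boot all_order all_algebra.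
From mathcomp Require Import all_classical all_reals all_analysis.
From mathcomp Require Import ring lra.

Import Order.TTheory GRing.Theory Num.Theory.
Import numFieldNormedType.Exports.

Local Open Scope classical_set_scope.
Local Open Scope ring_scope.

(** Passing from [x] to [q x] multiplies [1 / (-c x^2; q^2)_oo] by the polynomial
    [1 + c x^2], so each q-integral amounts to a linear identity between values
    of the special function at neighbouring points: [h_(n+1) (x)], [h_n (x)] and
    [h_n (q x)] in (a), [J (x / q)], [J (x)] and [J (q x)] in (b).  Both hold
    coefficientwise, hence for partial sums up to a shift of index, and pass to
    the limit.  In (b) the coefficient identity rests on
    [q^(-2n-nu) + q^(2n+nu) - q^nu - q^-nu
     = q^(-2n-nu) (1 - q^(2n)) (1 - q^(2n+2nu))]. *)

(** * Ratio test and q-shifted factorials *)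

Lemma cvgn_series_ratio {R : realType} (u : R^nat) (r : R) (N : nat) :
  0 <= r -> r < 1 ->
  (forall n, (N <= n)%N -> `|u n.+1| <= r * `|u n|) -> cvgn (series u).
Proof.
move=> r0 r1 ur.
have bound n : `|u (n + N)%N| <= `|u N| * r ^+ n.
  elim: n => [|n IH]; first by rewrite expr0 mulr1.
  rewrite addSn (le_trans (ur _ (leq_addl _ _)))// exprS mulrCA.
  by rewrite ler_wpM2l.
suff sN : cvgn (series (fun n => u (n + N)%N)).
  rewrite -(is_cvg_series_restrict N); apply/cvg_ex.
  move/cvg_ex : sN => [l ul]; exists l; rewrite -(cvg_shiftn N).
  rewrite (_ : [sequence _]_n = series (fun n => u (n + N)%N))//.
  by apply/funext => n; rewrite /= seriesEnat/= -{1}(add0n N) big_addn addnK.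
apply: normed_cvg; apply: (@series_le_cvg _ _ (geometric `|u N| r)) => [n|n|n|].
  exact: normr_ge0.
  by rewrite /= mulr_ge0 ?exprn_ge0.
  exact: bound.
by apply: is_cvg_geometric_series; rewrite ger0_norm.
Qed.

Lemma qpochS {R : realType} (a q : R) (k : nat) :
  qpoch a q k.+1 = qpoch a q k * (1 - a * q ^+ k).
Proof. by rewrite /qpoch big_nat_recr. Qed.

Lemma qpochSl {R : realType} (a q : R) (k : nat) :
  qpoch a q k.+1 = (1 - a) * qpoch (a * q) q k.
Proof.
rewrite /qpoch big_nat_recl//= expr0 mulr1; congr (_ * _).
by apply: eq_bigr => i _; rewrite exprS mulrA.
Qed.

Lemma qpoch_neq0 {R : realType} (a q : R) (k : nat) :
  0 <= q -> q <= 1 -> a < 1 -> qpoch a q k != 0.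
Proof.
move=> q0 q1 a1; elim: k => [|k IH]; first by rewrite /qpoch big_geq ?oner_neq0.
rewrite qpochS mulf_neq0// subr_eq0 eq_sym lt_eqF//.
have [a0|a0] := leP 0 a.
  by rewrite (le_lt_trans _ a1)// ler_piMr// exprn_ile1.
by rewrite (le_lt_trans _ ltr01)// mulr_le0_ge0 ?exprn_ge0// ltW.
Qed.

(** The partial products increase, and 1 + y <= e^y bounds them by the exponential of a geometric
    sum. *)
Lemma is_cvg_qpoch {R : realType} (c q : R) :
  0 <= c -> 0 < q -> q < 1 -> cvgn (fun k => qpoch (- c) q k).
Proof.
move=> c0 q0 q1; apply: nondecreasing_is_cvgn.
  apply/nondecreasing_seqP => n; rewrite qpochS mulNr opprK.
  have p0 : 0 <= qpoch (- c) q n.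
    by apply: prodr_ge0 => i _; rewrite mulNr opprK addr_ge0// mulr_ge0 ?exprn_ge0// ltW.
  by rewrite ler_peMr// lerDl mulr_ge0// exprn_ge0// ltW.
exists (expR (c * (1 - q)^-1)) => _ [n _ <-].
apply: (@le_trans _ _ (expR (series (geometric c q) n))); last first.
  by rewrite ler_expR geometric_le_lim// gtr0_norm.
rewrite /series/= expR_sum; apply: ler_prod => i _.
by rewrite mulNr opprK expR_ge1Dx addr_ge0// mulr_ge0 ?exprn_ge0// ltW.
Qed.

Lemma qpoch_infS {R : realType} (c q : R) : 0 <= c -> 0 < q -> q < 1 ->
  qpoch_inf (- c) q = (1 + c) * qpoch_inf (- (c * q)) q.
Proof.
move=> c0 q0 q1; rewrite /qpoch_inf.
have cq0 : 0 <= c * q by rewrite mulr_ge0// ltW.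
apply/cvg_lim => //; rewrite -cvg_shiftS.
rewrite (_ : [sequence _]_n = fun n => (1 + c) * qpoch (- (c * q)) q n).
  by apply: cvgMr; exact: is_cvg_qpoch.
by apply/funext => n /=; rewrite qpochSl opprK mulNr.
Qed.

(* The two infinite products vanish together, which covers the junk value
   [0^-1 = 0]. *)
Lemma qpoch_infS_inv {R : realType} (c q : R) : 0 <= c -> 0 < q -> q < 1 ->
  (qpoch_inf (- (c * q)) q)^-1 = (1 + c) / qpoch_inf (- c) q.
Proof.
move=> c0 q0 q1; rewrite (qpoch_infS c)// invfM mulrA mulfV ?mul1r//.
by rewrite gt_eqF// ltr_wpDr.
Qed.

(** * Discrete q-Hermite II polynomials *)

(* The summand of [qhermite2 n] is the case [a = q^-n]; the recurrence below
   holds for every [a], with [a q] in the role of [n - 1]. *)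
Definition qhermite2_term {R : realType} (a q x : R) (k : nat) : R :=
  qpoch a (q ^+ 2) k * qpoch (a * q) (q ^+ 2) k / qpoch (q ^+ 2) (q ^+ 2) k
  * (- q ^+ 2 / x ^+ 2) ^+ k.

Lemma qhermite2E {R : realType} (n : nat) (x q : R) : q != 0 ->
  qhermite2 n x q = x ^+ n * limn (series (qhermite2_term (q ^- n) q x)).
Proof. by move=> q0; rewrite /qhermite2 expfzDr// expr1z -exprnN. Qed.

Lemma qhermite2_term_rec {R : realType} (a q x : R) (k : nat) :
  0 < q -> q < 1 -> x != 0 ->
  x ^+ 2 * qhermite2_term a q x k.+1 =
    qhermite2_term (a * q) q (q * x) k - a * q * qhermite2_term (a * q) q x k
    + x ^+ 2 * qhermite2_term (a * q) q (q * x) k.+1.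
Proof.
move=> q0 q1 x0; rewrite /qhermite2_term.
have q2lt1 : q ^+ 2 < 1 by rewrite expr_lt1// ltW.
have := @qpoch_neq0 _ (q ^+ 2) (q ^+ 2) k.+1 (exprn_ge0 _ (ltW q0)) (ltW q2lt1) q2lt1.
(* Taking the first factor off (a; q^2)_(k+1) and the last one off every other symbol leaves (a q;
   q^2)_k (a q^2; q^2)_k as a common factor of all terms. *)
rewrite (qpochSl a) !(qpochS _ _ k) mulf_eq0 negb_or => /andP[D0 r0].
have qn0 : q != 0 by rewrite gt_eqF.
have qk0 : q ^+ k != 0 by rewrite expf_neq0.
have xk0 : x ^+ k != 0 by rewrite expf_neq0.
rewrite -(mulrA a q q) -expr2 !exprMn !exprS !expr0 !mulr1 !exprVn !exprMn in D0 r0 *.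
by field; do ?[apply/andP; split].
Qed.

Lemma is_cvg_qhermite2 {R : realType} (n : nat) (q x : R) : q != 0 ->
  cvgn (series (qhermite2_term (q ^- n) q x)).
Proof.
(* The terms of index greater than [n] vanish: ratio test with ratio 0. *)
move=> q0; apply: (@cvgn_series_ratio _ _ 0 n) => // k nk.
suff -> : qhermite2_term (q ^- n) q x k.+1 = 0 by rewrite normr0 mul0r.
have vanish (a : R) j : (j < k.+1)%N -> a * q ^+ 2 ^+ j = 1 ->
    qpoch a (q ^+ 2) k.+1 = 0.
  move=> jk aj; apply/eqP; rewrite prodf_seq_eq0; apply/hasP.
  by exists j; rewrite ?mem_index_iota//= aj subrr.
have jk : (n./2 < k.+1)%N by rewrite ltnS (leq_trans _ nk)// leq_half_double
    -addnn leqW// leq_addr.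
(* The factor of index [n./2] vanishes: in the second symbol, with parameter q^(1-n), for odd [n],
   and in the first for even [n]. *)
rewrite /qhermite2_term; have := odd_double_half n; case: (odd n) => /= nE.
  rewrite (vanish (q ^- n * q) _ jk) ?mulr0 ?mul0r//.
  by rewrite -exprM mul2n -mulrA -exprS -{1}nE add1n mulVf// expf_neq0.
rewrite (vanish (q ^- n) _ jk) ?mul0r//.
by rewrite -exprM mul2n -{1}nE add0n mulVf// expf_neq0.
Qed.

(** Multiplied by [x ^+ m], this is the three-point relation x h_(m+1)(x) = q^-m ((1 + x^2) h_m(q x)
    - h_m(x)). *)
Lemma qhermite2_series_rec {R : realType} (m : nat) (q x : R) :
  0 < q -> q < 1 -> x != 0 ->
  x ^+ 2 * limn (series (qhermite2_term (q ^- m.+1) q x)) =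
    (1 + x ^+ 2) * limn (series (qhermite2_term (q ^- m) q (q * x)))
    - q ^- m * limn (series (qhermite2_term (q ^- m) q x)).
Proof.
move=> q0 q1 x0; have qn0 : q != 0 by rewrite gt_eqF.
set S := series (qhermite2_term (q ^- m.+1) q x).
set S1 := series (qhermite2_term (q ^- m) q (q * x)).
set S2 := series (qhermite2_term (q ^- m) q x).
have aq : q ^- m.+1 * q = q ^- m by rewrite exprSr invfM -mulrA mulVf// mulr1.
have T0 a y : qhermite2_term a q y 0 = 1.
  by rewrite /qhermite2_term /qpoch !big_geq// divr1 !mulr1.
(* The term recurrence links index k+1 to both k and k+1, hence the staggered partial sums; at N = 0
   the zeroth terms, all equal to 1, match. *)
have SE N : x ^+ 2 * S N.+1 = x ^+ 2 * S1 N.+1 + S1 N - q ^- m * S2 N.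
  elim: N => [|N IH].
    by rewrite /S /S1 /S2 /series/= !big_nat1 !big_geq// !T0 mulr0 addr0 subr0.
  rewrite [S _]seriesSr mulrDr IH qhermite2_term_rec// aq.
  have S1S k : S1 k.+1 = S1 k + _ k := seriesSr _ k.
  have S2S k : S2 k.+1 = S2 k + _ k := seriesSr _ k.
  by rewrite !S1S S2S; ring.
have cS (y : R) k : cvgn (series (qhermite2_term (q ^- k) q y)).
  exact: is_cvg_qhermite2.
apply: (@cvg_unique _ (@Rhausdorff R) ((fun N => x ^+ 2 * S N.+1) @ \oo)).
  apply: cvgMr; rewrite (cvg_shiftS S); exact: cS.
rewrite (funext SE) mulrDl mul1r (addrC (limn S1)).
by apply: cvgB; [apply: cvgD; [apply: cvgMr; rewrite (cvg_shiftS S1)|]|apply: cvgMr];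
  exact: cS.
Qed.

(** * The series of the second Jackson q-Bessel function *)

(** The summand of [qbesselJ2] without its constant prefactor, with [t] standing for
    [x * (1 - q)]. *)
Definition jackson2_term {R : realType} (nu q t : R) (n : nat) : R :=
  (-1) ^+ n * q `^ (2 * n%:R * (n%:R + nu))
  / (qpoch (q ^+ 2) (q ^+ 2) n * qpoch (q `^ (2 * nu + 2)) (q ^+ 2) n)
  * t `^ (2 * n%:R + nu).

Lemma powRD_gt0 {R : realType} (x a b : R) : 0 < x ->
  x `^ (a + b) = x `^ a * x `^ b.
Proof. by move=> x0; rewrite powRD// (gt_eqF x0) implybT. Qed.

Lemma powR_2nD {R : realType} (x nu : R) (n : nat) : 0 < x ->
  x `^ (2 * n%:R + nu) = (x ^+ n) ^+ 2 * x `^ nu.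
Proof.
move=> x0; rewrite powRD_gt0//.
by rewrite -natrM powR_mulrn ?ltW// mulnC exprM.
Qed.

Lemma powR_2nu2 {R : realType} (x nu : R) : 0 < x ->
  x `^ (2 * nu + 2) = (x `^ nu) ^+ 2 * x ^+ 2.
Proof.
move=> x0; rewrite powRD_gt0//.
by rewrite [2 * nu]mulrC powRrM !powR_mulrn ?powR_ge0 ?ltW.
Qed.

Lemma powR_2nu2_lt1 {R : realType} (q nu : R) : 0 < q -> q < 1 -> -1 < nu ->
  q `^ (2 * nu + 2) < 1.
Proof.
move=> q0 q1 nu1; have w0 : 0 < 2 * nu + 2 by lra.
rewrite -[ltRHS](_ : 1 `^ (2 * nu + 2) = 1); last by rewrite powR1.
by rewrite gt0_ltr_powR// nnegrE ltW.
Qed.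

Lemma jackson2_termM {R : realType} (nu q t : R) (n : nat) : 0 < q -> 0 < t ->
  jackson2_term nu q (q * t) n = q `^ nu * (q ^+ n) ^+ 2 * jackson2_term nu q t n.
Proof.
move=> q0 t0; rewrite /jackson2_term powRM ?ltW// (powR_2nD _ _ _ q0).
ring.
Qed.

(** The ratio of consecutive terms, cleared of denominators: the left factors are the new factors of
    the two symbols, and the exponent of q grows by 4n + 2nu + 2. It serves both convergence and the
    three-point relation. *)
Lemma jackson2_termS {R : realType} (nu q t : R) (n : nat) :
  0 < q -> q < 1 -> -1 < nu -> 0 < t ->
  (1 - (q ^+ n.+1) ^+ 2) * (1 - (q `^ nu * q ^+ n.+1) ^+ 2)
    * jackson2_term nu q t n.+1
  = - (q `^ nu * t * (q ^+ n) ^+ 2 * q) ^+ 2 * jackson2_term nu q t n.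
Proof.
move=> q0 q1 nu1 t0; rewrite /jackson2_term !powR_2nD//.
have -> : q `^ (2 * n.+1%:R * (n.+1%:R + nu)) =
    q `^ (2 * n%:R * (n%:R + nu)) * (q `^ nu * (q ^+ n) ^+ 2 * q) ^+ 2.
  have -> : 2 * n.+1%:R * (n.+1%:R + nu) =
      2 * n%:R * (n%:R + nu) + (4 * n%:R + 2 * nu + 2) :> R.
    by rewrite -natr1; ring.
  rewrite powRD_gt0//; congr (_ * _).
  rewrite -addrA powRD_gt0//.
  by rewrite powR_2nu2// -natrM powR_mulrn ?ltW// mulnC exprM; ring.
have q2lt1 : q ^+ 2 < 1 by rewrite expr_lt1// ltW.
have q20 : 0 <= q ^+ 2 by rewrite exprn_ge0// ltW.
have := qpoch_neq0 _ _ n.+1 q20 (ltW q2lt1) q2lt1.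
have := qpoch_neq0 _ _ n.+1 q20 (ltW q2lt1) (powR_2nu2_lt1 _ _ q0 q1 nu1).
rewrite !qpochS !mulf_eq0 !negb_or powR_2nu2// => /andP[B0 b0] /andP[A0 a0].
rewrite !(exprAC q 2 n) in b0 a0 *; rewrite !(exprS q n) !(exprS t n) !(exprS (-1) n).
by field; do ?[apply/andP; split]; rewrite // !exprMn.
Qed.

Lemma is_cvg_jackson2 {R : realType} (nu q t : R) :
  0 < q -> q < 1 -> -1 < nu -> 0 < t -> cvgn (series (jackson2_term nu q t)).
Proof.
move=> q0 q1 nu1 t0.
have q2lt1 : q ^+ 2 < 1 by rewrite expr_lt1// ltW.
have w1 := powR_2nu2_lt1 _ _ q0 q1 nu1; rewrite powR_2nu2// in w1.
(* The ratio of consecutive terms has absolute value K q^(4n) / D, where [D] is at least its value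
   [d] at n = 0; the weaker bound (K / d) q^n already tends to 0. *)
pose K := (q `^ nu * t * q) ^+ 2.
pose d : R := (1 - q ^+ 2) * (1 - (q `^ nu) ^+ 2 * q ^+ 2).
have d0 : 0 < d by rewrite mulr_gt0// subr_gt0.
have K0 : 0 <= K by rewrite sqr_ge0.
have Kq : (K / d) * q ^+ n @[n --> \oo] --> (K / d) * 0.
  by apply: cvgMr; apply: cvg_expr; rewrite gtr0_norm.
have [N _ hN] : \forall n \near \oo, (K / d) * q ^+ n <= 2^-1.
  by apply: cvgr_le Kq _ _; rewrite mulr0; lra.
apply: (@cvgn_series_ratio _ _ 2^-1 N); [lra|lra|move=> n /hN {}hN].
have qn0 : 0 <= q ^+ n by rewrite exprn_ge0// ltW.
have qn1 : q ^+ n <= 1 by rewrite exprn_ile1// ltW.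
have q20 : 0 <= q ^+ 2 by rewrite sqr_ge0.
have qn2 : (q ^+ n) ^+ 2 <= 1 by rewrite exprn_ile1.
pose D : R := (1 - (q ^+ n.+1) ^+ 2) * (1 - (q `^ nu * q ^+ n.+1) ^+ 2).
have dD : d <= D.
  have Q0 : 0 <= (q `^ nu) ^+ 2 * q ^+ 2 by rewrite mulr_ge0 ?sqr_ge0.
  rewrite /D (exprS q n) !exprMn mulrA.
  by rewrite ler_pM ?subr_ge0 ?(ltW q2lt1) ?(ltW w1)// lerD2l lerN2 ler_piMr.
have := jackson2_termS nu q t n q0 q1 nu1 t0.
move: (jackson2_term nu q t n) (jackson2_term nu q t n.+1) => u v.
rewrite -/D => /(congr1 Num.norm).
rewrite (normrM D) (gtr0_norm (lt_le_trans d0 dD)) normrM normrN.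
rewrite (ger0_norm (sqr_ge0 _)) => e; rewrite -(ler_pM2l d0).
apply: le_trans (ler_wpM2r (normr_ge0 _) dD) _; rewrite e.
rewrite [leRHS]mulrA ler_wpM2r//.
apply: (@le_trans _ _ (K * q ^+ n)); last first.
  by rewrite -ler_pdivrMl// mulrA (mulrC _ K).
rewrite [leLHS](_ : _ = K * q ^+ n * (q ^+ n) ^+ 3); last by rewrite /K; ring.
by apply: ler_piMr; [exact: mulr_ge0|exact: exprn_ile1].
Qed.

(** The q-difference equation of the Bessel series, centred at [q * t]. The factor [(q * t) ^+ 2]
    raises the degree by two, so it pairs the partial sum up to N with the others up to N+1. *)
Lemma jackson2_series_eq {R : realType} (nu q t : R) :
  0 < q -> q < 1 -> -1 < nu -> 0 < t ->
  limn (series (jackson2_term nu q t))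
  + (1 + (q * t) ^+ 2) * limn (series (jackson2_term nu q (q * (q * t))))
  = ((q `^ nu)^-1 + q `^ nu) * limn (series (jackson2_term nu q (q * t))).
Proof.
move=> q0 q1 nu1 t0; have qt0 : 0 < q * t by rewrite mulr_gt0.
have qqt0 : 0 < q * (q * t) by rewrite mulr_gt0.
have Q0 : q `^ nu != 0 by rewrite gt_eqF// powR_gt0.
set S := series (jackson2_term nu q t).
set S1 := series (jackson2_term nu q (q * t)).
set S2 := series (jackson2_term nu q (q * (q * t))).
have SE N : S N.+1 + (S2 N.+1 + (q * t) ^+ 2 * S2 N) =
    ((q `^ nu)^-1 + q `^ nu) * S1 N.+1.
  elim: N => [|N IH].
    rewrite /S /S1 /S2 /series/= !big_nat1 big_geq// mulr0 addr0.
    by rewrite !jackson2_termM// !expr0; field.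
  have S0S k : S k.+1 = S k + _ k := seriesSr _ k.
  have S1S k : S1 k.+1 = S1 k + _ k := seriesSr _ k.
  have S2S k : S2 k.+1 = S2 k + _ k := seriesSr _ k.
  have cS2 : (q * t) ^+ 2 * S2 N.+1 = (q * t) ^+ 2 * S2 N +
      (q * t) ^+ 2 * jackson2_term nu q (q * (q * t)) N by rewrite S2S mulrDr.
  rewrite S0S (S2S N.+1) cS2 (S1S N.+1) [RHS]mulrDr -IH.
  have := jackson2_termS nu q t N q0 q1 nu1 t0.
  rewrite !jackson2_termM//.
  move: (q `^ nu) (jackson2_term nu q t) Q0 => Q u Q0 e.
  apply/eqP; rewrite -subr_eq0.
  (* With y = q^(2N+2), the factor of [u N.+1] is 1 + Q^2 y^2 - y - Q^2 y = (1 - y)(1 - Q^2 y), so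
     the difference vanishes by the term recurrence [e]. *)
  rewrite (_ : _ - _ = (1 - (q ^+ N.+1) ^+ 2) * (1 - (Q * q ^+ N.+1) ^+ 2) * u N.+1
    + (Q * t * (q ^+ N) ^+ 2 * q) ^+ 2 * u N); first by rewrite e; apply/eqP; ring.
  by field.
have cS (y : R) : 0 < y -> cvgn (series (jackson2_term nu q y)).
  exact: is_cvg_jackson2.
apply: (@cvg_unique _ (@Rhausdorff R)
    ((fun N => ((q `^ nu)^-1 + q `^ nu) * S1 N.+1) @ \oo)); last first.
  by apply: cvgMr; rewrite (cvg_shiftS S1); exact: cS.
rewrite -(funext SE) mulrDl mul1r.
by apply: cvgD; [rewrite (cvg_shiftS S); exact: cS|];
  apply: cvgD; [rewrite (cvg_shiftS S2); exact: cS|apply: cvgMr; exact: cS].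
Qed.

(** * The two q-integrals from the three-point relations *)

Theorem theorem3p2 (R : realType) (q : R) (hq0 : 0 < q) (hq1 : q < 1) :
  (forall n : nat, (0 < n)%N ->
     is_qintegral q [set x : R | x != 0]
       (fun x => qhermite2 n x q / qpoch_inf (- x ^+ 2) (q ^+ 2))
       (fun x => - (q ^ (1 - n%:Z) * (1 - q) / qpoch_inf (- x ^+ 2) (q ^+ 2))
                 * qhermite2 n.-1 x q))
  /\
  (forall nu : R, -1 < nu ->
     is_qintegral q [set x : R | 0 < x]
       (fun x => (q * x ^+ 2 - q `^ (1 - nu) * qnum q nu ^+ 2)
                 / (x * qpoch_inf (- (x ^+ 2) * (1 - q) ^+ 2) (q ^+ 2))
                 * qbesselJ2 nu x q)
       (fun x => - x / qpoch_inf (- (x ^+ 2) * (1 - q) ^+ 2) (q ^+ 2)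
                 * Dq q^-1 (fun y => qbesselJ2 nu y q) x)).
Proof.
have qn0 : q != 0 by rewrite gt_eqF.
have q20 : 0 < q ^+ 2 by rewrite exprn_gt0.
have q21 : q ^+ 2 < 1 by rewrite expr_lt1// ltW.
have p0 : 1 - q != 0 by rewrite subr_eq0 eq_sym lt_eqF.
split=> [[//|m] _ x /= x0|nu nu1 x /= x0].
  rewrite /Dq !qhermite2E//= !invfM.
  have -> : - (q * x) ^+ 2 = - (x ^+ 2 * q ^+ 2) by rewrite exprMn mulrC.
  rewrite qpoch_infS_inv ?sqr_ge0//.
  have -> : q ^ (1 - m.+1%:Z) = q ^- m.
    by rewrite -addn1 PoszD opprD addrCA subrr addr0 -exprnN.
  have := qhermite2_series_rec m _ _ hq0 hq1 x0.
  move: (limn _ : R) (limn _ : R) (limn _ : R) (qpoch_inf _ _)^-1 => S2 S1 S E e.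
  have -> : S = ((1 + x ^+ 2) * S1 - q ^- m * S2) / x ^+ 2.
    by rewrite -e mulrAC mulfV ?mul1r// expf_neq0.
  rewrite exprMn (exprS x m).
  by field; do ?[apply/andP; split]; rewrite // expf_neq0.
(* [Dq q^-1] at x and at q x evaluates J at x/q, x and q x, that is, the series at t, q t and q^2 t
   for t = x (1 - q) / q. *)
have t0 : 0 < q^-1 * x * (1 - q) by rewrite !mulr_gt0 ?invr_gt0// subr_gt0.
have := jackson2_series_eq _ _ _ hq0 hq1 nu1 t0.
have -> : q * (q^-1 * x * (1 - q)) = x * (1 - q) by rewrite -mulrA mulVKf.
rewrite /Dq mulKf// /qnum /qbesselJ2 -!/(jackson2_term _ _ _) -(mulrA q x).
have -> : q `^ (1 - nu) = q / q `^ nu by rewrite powRD_gt0// powRr1 ?ltW// powRN.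
have Q0 : q `^ nu != 0 by rewrite gt_eqF// powR_gt0.
have xn0 : x != 0 by rewrite gt_eqF.
have -> : - ((q * x) ^+ 2) * (1 - q) ^+ 2 = - ((x * (1 - q)) ^+ 2 * q ^+ 2).
  by ring.
rewrite qpoch_infS_inv ?sqr_ge0// [- x ^+ 2 * _]mulNr -[x ^+ 2 * _]exprMn !invfM.
set C := qpoch_inf _ _ / _; set E := (qpoch_inf _ _)^-1.
move: (limn _ : R) (limn _ : R) (limn _ : R) => L2 L1 L0.
move: (q `^ nu) Q0 => Q Q0 e.
(* [L0], [L2] and [L1] are the series for x/q, x and q x, in this order; eliminating [L0] leaves a
   rational identity. *)
have -> : L0 = (Q^-1 + Q) * L2 - (1 + (x * (1 - q)) ^+ 2) * L1 by rewrite -e addrK.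
by field; rewrite xn0 p0 Q0 qn0 -opprB oppr_eq0 p0.
Qed.
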